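(* For any two pairs of five-point real signals $(x,y)$ and $(\tilde x,\tilde y)$, with $x,y,\tilde x,\tilde y\in\mathbb{R}^5$, $$\|\Psi(x,y)-\Psi(\tilde x,\tilde y)\|_2\le 2\left(\|x-\tilde x\|_\infty+\|y-\tilde y\|_\infty\right),$$ where $\Psi(x,y)=\left(F_1^0[x],F_2^0[x],F_3^0[x],\beta_2^1[x],F_1^0[y],F_2^0[y],F_3^0[y],\beta_2^1[y]\right)\in\mathbb{R}^8$ is the two-channel F-transform descriptor.
   Context: On the sample points $t\in\{0,1,2,3,4\}$ take centers $c_1=0$, $c_2=2$, $c_3=4$, bandwidth $h=2$, and triangular basic functions $A_j(t)=\max\left(0,\,1-\frac{|t-c_j|}{h}\right)$ for $j=1,2,3$. For a five-point real signal $z=(z_0,z_1,z_2,z_3,z_4)$ define $$F_j^0[z]=\frac{\sum_{t=0}^4 z_tA_j(t)}{\sum_{t=0}^4 A_j(t)},\quad j=1,2,3,\qquad \beta_2^1[z]=\frac{\sum_{t=0}^4 z_t(t-c_2)A_2(t)}{\sum_{t=0}^4 (t-c_2)^2A_2(t)}.$$ Here $\|\cdot\|_2$ is the Euclidean norm on $\mathbb{R}^8$ and $\|\cdot\|_\infty$ is the sup norm on $\mathbb{R}^5$. *)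

(* Defs.v *)
From HB Require Import structures.
From mathcomp Require Import all_boot all_order all_algebra.
From mathcomp Require Import reals topology normedtype.

Set Implicit Arguments.
Unset Strict Implicit.
Unset Printing Implicit Defensive.

Import Order.TTheory GRing.Theory Num.Theory.
Import numFieldNormedType.Exports.

Local Open Scope ring_scope.

Section FTransform.
Variable R : realType.

(* 0-based: [ft_center 0], [ft_center 1], [ft_center 2] are c_1, c_2, c_3, and
   likewise for the index of [basic], [F0] and [beta1]. *)
Definition ft_center (j : 'I_3) : R := tnth [tuple 0; 2; 4] j.

Definition bandwidth : R := 2.

Definition basic (j : 'I_3) (t : R) : R :=
  Num.max 0 (1 - `|t - ft_center j| / bandwidth).

Definition F0 (j : 'I_3) (z : 'rV[R]_5) : R :=
  (\sum_(t < 5) z ord0 t * basic j t%:R) / (\sum_(t < 5) basic j t%:R).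

Definition beta1 (j : 'I_3) (z : 'rV[R]_5) : R :=
  (\sum_(t < 5) z ord0 t * (t%:R - ft_center j) * basic j t%:R) /
  (\sum_(t < 5) (t%:R - ft_center j) ^+ 2 * basic j t%:R).

Definition Psi (x y : 'rV[R]_5) : 'rV[R]_8 :=
  \row_(k < 8) tnth [tuple F0 0 x; F0 1 x; F0 2 x; beta1 1 x;
                           F0 0 y; F0 1 y; F0 2 y; beta1 1 y] k.

(* The library norm `|v| on row vectors is the sup norm, not the Euclidean one. *)
Definition l2norm (n : nat) (v : 'rV[R]_n) : R :=
  Num.sqrt (\sum_(i < n) v ord0 i ^+ 2).

End FTransform.

(* Main.v *)
Require Import Defs.
From HB Require Import structures.
From mathcomp Require Import all_boot all_order all_algebra.
From mathcomp Require Import reals topology normedtype.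
From mathcomp Require Import lra.

Set Implicit Arguments.
Unset Strict Implicit.
Unset Printing Implicit Defensive.

Import Order.TTheory GRing.Theory Num.Theory.
Import numFieldNormedType.Exports.

Local Open Scope ring_scope.

(** Each component of the descriptor is a linear functional
    [z |-> (\sum_t z_t w_t) / D] of one channel, and each has norm at most 1
    for the sup norm, because [\sum_t `|w_t| <= D] ([norm_weighted_quotient_le]).
    For [F0] the weights are the nonnegative values of the basic function and
    [D] is their sum.  For [beta1] the weights are [(t - c_j) A_j(t)] and [D] is
    the sum of the [(t - c_j)^2 A_j(t)]: sample points and centers are integers,
    so [t - c_j] vanishes or has absolute value at least 1, and hence
    [`|t - c_j| <= (t - c_j)^2].

    With [a] and [b] the sup norms of the two channel differences, four
    components of the descriptor difference are therefore bounded by [a] and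
    four by [b], so that its squared Euclidean norm is at most
    [4 (a^2 + b^2) <= (2 (a + b))^2]. *)

Section Bounds.
Variable R : realType.
Implicit Types (z u v : 'rV[R]_5) (j : 'I_3).

Lemma F0B j u v : F0 j (u - v) = F0 j u - F0 j v.
Proof.
rewrite /F0 -mulrBl -sumrB; congr (_ / _).
by apply: eq_bigr => t _; rewrite !mxE mulrBl.
Qed.

Lemma beta1B j u v : beta1 j (u - v) = beta1 j u - beta1 j v.
Proof.
rewrite /beta1 -mulrBl -sumrB; congr (_ / _).
by apply: eq_bigr => t _; rewrite !mxE !mulrBl.
Qed.

Lemma basic_ge0 j (t : R) : 0 <= basic j t.
Proof. by rewrite /basic le_max lexx. Qed.

Lemma norm_entry_le (n : nat) (z : 'rV[R]_n) (t : 'I_n) : `|z ord0 t| <= `|z|.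
Proof.
rewrite [leRHS]mx_normrE.
exact: (le_bigmax _ (fun i : 'I_1 * 'I_n => `|z i.1 i.2|) (ord0, t)).
Qed.

(** Hölder's inequality for the pairing of the sup norm with the l1 norm, in the
    shape shared by [F0] and [beta1]. *)
Lemma norm_weighted_quotient_le (n : nat) (z : 'rV[R]_n) (w : 'I_n -> R) (D : R) :
  \sum_(t < n) `|w t| <= D -> `|(\sum_(t < n) z ord0 t * w t) / D| <= `|z|.
Proof.
move=> wD; have D0 : 0 <= D by apply: le_trans wD; apply: sumr_ge0.
have zwD : `|\sum_(t < n) z ord0 t * w t| <= `|z| * D.
  apply: le_trans (ler_norm_sum _ _ _) _.
  apply: le_trans (ler_wpM2l (normr_ge0 _) wD); rewrite mulr_sumr.
  by apply: ler_sum => t _; rewrite normrM ler_wpM2r // norm_entry_le.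
have [-> | Dn0] := eqVneq D 0; first by rewrite invr0 mulr0 normr0.
by rewrite normrM normfV (ger0_norm D0) ler_pdivrMr // lt_def Dn0.
Qed.

Lemma norm_F0_le j z : `|F0 j z| <= `|z|.
Proof.
apply: norm_weighted_quotient_le; apply: ler_sum => t _.
by rewrite ger0_norm // basic_ge0.
Qed.

(** Integrality replaces the computation of the weights in [beta1]: the
    inequality fails for reals strictly between 0 and 1. *)
Lemma norm_int_le_sqr (k : int) : `|k%:~R : R| <= k%:~R ^+ 2.
Proof.
rewrite -intr_norm -rmorphXn ler_int -[leRHS]real_normK ?num_real // -abszE.
by case: `|k|%N => [|m] //; rewrite expr2 ler_peMl.
Qed.

Lemma ft_center_int j : exists k : int, ft_center R j = k%:~R.
Proof.
by case: j => [[|[|[|//]]] ?]; [exists 0 | exists 2 | exists 4].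
Qed.

Lemma norm_beta1_le j z : `|beta1 j z| <= `|z|.
Proof.
rewrite /beta1; under eq_bigr do rewrite -mulrA.
apply: norm_weighted_quotient_le; apply: ler_sum => t _.
rewrite normrM (ger0_norm (basic_ge0 _ _)) ler_wpM2r ?basic_ge0 //.
have [k ->] := ft_center_int j.
by rewrite -[t%:R]/((t : int)%:~R) -intrB norm_int_le_sqr.
Qed.

End Bounds.

Theorem proposition3p3 (R : realType) (x y x' y' : 'rV[R]_5) :
  l2norm (Psi x y - Psi x' y') <= 2 * (`|x - x'| + `|y - y'|).
Proof.
have a0 := normr_ge0 (x - x'); have b0 := normr_ge0 (y - y').
have sqr_le (r s : R) : `|r| <= s -> r ^+ 2 <= s ^+ 2.
  by move=> rs; rewrite -real_normK ?num_real // lerXn2r // nnegrE //; apply: le_trans rs.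
have F0x j := sqr_le _ _ (norm_F0_le j (x - x')).
have F0y j := sqr_le _ _ (norm_F0_le j (y - y')).
have bx := sqr_le _ _ (norm_beta1_le 1 (x - x')).
have byy := sqr_le _ _ (norm_beta1_le 1 (y - y')).
have ab := mulr_ge0 a0 b0.
rewrite /l2norm -[leRHS]ger0_norm; last by lra.
rewrite -sqrtr_sqr ler_wsqrtr // !big_ord_recl big_ord0 !mxE /= !(tnth_nth 0) /=.
rewrite -!F0B -!beta1B.
have := F0x 0; have := F0x 1; have := F0x 2.
have := F0y 0; have := F0y 1; have := F0y 2.
(* The slack in the bound is the cross term [8 a b], nonnegative by [ab]. *)
lra.
Qed.
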